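(* Consider an instance of the rental-harmony problem with $k$ roommates and $k-1$ rooms (satisfying the assumptions in the context). Then there exists a division of the rent such that, no matter which one roommate is kicked out, there is an envy-free assignment of the $k-1$ rooms to the remaining $k-1$ roommates, i.e., a bijection between rooms and remaining roommates in which each roommate receives one of her preferred rooms for that rent division.
   Context: A fixed total rent is to be divided among the rooms: a rent division is an assignment of a nonnegative price to each room, the prices summing to the total rent. For each rent division, each roommate has a nonempty set of preferred rooms (she may prefer several). Assumptions: (i) a roommate will not envy the others if she gets a room for free, i.e., in any rent division, any room whose price is zero is among the preferred rooms of each roommate; (ii) closedness: if a roommate prefers a given room for every rent division of a converging sequence of rent divisions, she also prefers that room for the limit rent division. An assignment of rooms to roommates is envy-free if each roommate receives one of her preferred rooms. *)

(* Defs.v *)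
From mathcomp Require Import all_boot.
From Stdlib Require Import Reals.
Set Implicit Arguments. Unset Strict Implicit. Unset Printing Implicit Defensive.
Open Scope R_scope.

Definition rent_division (n : nat) (rent : R) (p : 'I_n -> R) : Prop :=
  (forall j, 0 <= p j) /\ \big[Rplus/0]_(j < n) p j = rent.

Definition preference (n : nat) := ('I_n -> R) -> 'I_n -> Prop.

Definition nonempty_pref (n : nat) (rent : R) (P : preference n) : Prop :=
  forall p, rent_division rent p -> exists j, P p j.

Definition free_room_pref (n : nat) (rent : R) (P : preference n) : Prop :=
  forall p j, rent_division rent p -> p j = 0 -> P p j.

(* Closedness: convergence of rent divisions is coordinatewise (finite dim). *)
Definition closed_pref (n : nat) (rent : R) (P : preference n) : Prop :=
  forall (s : nat -> 'I_n -> R) (p : 'I_n -> R) (j : 'I_n),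
    (forall m, rent_division rent (s m)) -> rent_division rent p ->
    (forall i, Un_cv (fun m => s m i) (p i)) ->
    (forall m, P (s m) j) -> P p j.

Definition valid_pref (n : nat) (rent : R) (P : preference n) : Prop :=
  nonempty_pref rent P /\ free_room_pref rent P /\ closed_pref rent P.

(* Main.v *)
Require Import Defs.
From mathcomp Require Import all_boot.
From Stdlib Require Import Reals.
From Stdlib Require Import Lra ClassicalEpsilon.
From mathcomp Require Import all_order all_algebra zify.
From mathcomp Require ring lra.
Open Scope R_scope.
Set Implicit Arguments. Unset Strict Implicit. Unset Printing Implicit Defensive.

(** Restrict the prices to the grid of multiples of [rent / N].  Let
    roommate [i] divide one unit of weight among the rooms, giving room [j] a
    share proportional to [max (0, r - d)], where [d] is the distance from the
    current grid point to the nearest grid point at which [i] prefers [j].  The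
    shares vary slowly when [r] is large, and free rooms receive at least an
    average share.  Scarf's combinatorial lemma, for the colouring of each grid
    point by a room of maximal total load, gives a grid point at which every one
    of the [n] rooms has load greater than [1], although the [n + 1] roommates
    supply one unit each.  So every nonempty set [K] of rooms is nearly preferred
    by more than [#|K|] roommates, and Hall's condition survives the removal of
    any roommate.  Since [r] does not depend on [N], "nearly" disappears in the
    limit [N -> oo] by compactness and closedness. *)

(** * Dominating sets for a family of linear orders *)

Section Scarf.
Local Open Scope nat_scope.
Variables (Z J : finType) (F : J -> Z -> nat).
Hypothesis F_inj : forall j, injective (F j).

(** For nonempty [T], this says that no element lies strictly above the minimum of [T] in all the
    orders at once. *)
Definition dominating (T : {set Z}) : bool :=
  [forall z, [exists j, [forall t in T, F j z <= F j t]]].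

Lemma dominatingP (T : {set Z}) :
  reflect (forall z, exists j, {in T, forall t, F j z <= F j t}) (dominating T).
Proof.
apply: (iffP forallP) => H z; have := H z.
  by case/existsP=> j /forall_inP Hj; exists j.
by case=> j Hj; apply/existsP; exists j; apply/forall_inP.
Qed.

Lemma argmin_of (T : {set Z}) : T != set0 ->
  exists m : J -> Z, (forall j, m j \in T) /\
    (forall j, {in T, forall t, F j (m j) <= F j t}).
Proof.
case/set0Pn=> t0 t0T.
exists (fun j => [arg min_(t < t0 in T) F j t]); split=> j.
  by case: arg_minnP.
by case: arg_minnP => // i iT H t tT; apply: H.
Qed.

(** Domination applied to an element of [T] itself gives an order in which that element is the
    minimum of [T]. *)
Lemma argmin_onto (T : {set Z}) (m : J -> Z) : dominating T ->
  (forall j, m j \in T) -> (forall j, {in T, forall t, F j (m j) <= F j t}) ->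
  m @: [set: J] = T.
Proof.
move=> /dominatingP dT mT mmin; apply/setP=> z; apply/imsetP/idP.
  by case=> j _ ->.
move=> zT; have [j Hj] := dT z; exists j => //.
by apply: (@F_inj j); apply/eqP; rewrite eqn_leq (Hj _ (mT j)) mmin.
Qed.

(* The minima [m j] hit every element of [T] by domination, so exactly two orders
   [a] and [b] share a minimum.  An element extends [T] exactly when it is the
   maximum, for the order [a] (or [b]), of the elements lying above the minima
   of [T] for all other orders. *)
Lemma dominating_extensions (T : {set Z}) :
  T != set0 -> #|T|.+1 = #|J| -> dominating T ->
  (forall m : J -> Z, (forall j, {in T, forall t, F j (m j) <= F j t}) ->
     forall i, exists z, forall j, j != i -> F j (m j) < F j z) ->
  #|[set z | z \notin T & dominating (z |: T)]| = 2.
Proof.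
move=> T0 card_T dT Hbig.
have [m [mT mmin]] := argmin_of T0.
have mTE := argmin_onto dT mT mmin.
have /dominatingP dTP := dT.
have [a [b [neq_ab mab]]] : exists a b, a != b /\ m a = m b.
  case: (boolP (injectiveb m)) => [/injectiveP m_inj|/injectivePn[a [b ab E]]].
    by have := card_imset [set: J] m_inj; rewrite mTE cardsT; lia.
  by exists a, b.
(* Without [a], or without [b], there remain [#|T|] orders whose minima still cover [T]. *)
have m_inj i : i \in [set a; b] -> {in [set~ i] &, injective m}.
  move=> iab; apply/imset_injP; rewrite cardsC1 -card_T.
  suff -> : m @: [set~ i] = T by rewrite /= eqxx.
  apply/eqP; rewrite eqEsubset; apply/andP; split.
    by apply/subsetP=> z /imsetP[j _ ->].
  rewrite -{1}mTE; apply/subsetP=> z /imsetP[j _ ->].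
  have [->|ji] := eqVneq j i; last by apply: imset_f; rewrite !inE.
  move: iab; rewrite !inE => /orP[]/eqP->.
    by rewrite mab imset_f // !inE eq_sym.
  by rewrite -mab imset_f // !inE.
pose M i := [set z | [forall (j | j != i), F j (m j) < F j z]].
have MP i z : reflect (forall j, j != i -> F j (m j) < F j z) (z \in M i).
  by rewrite inE; apply: (iffP forall_inP).
(* Some order puts [z] at or below all of [T], and membership in [M i] rules out every order but
   [i]. *)
have dM z i : z \in M i -> {in T, forall t, F i z <= F i t}.
  move=> /MP zM; have [j Hj] := dTP z; have [<-//|ji] := eqVneq j i.
  by have := zM _ ji; have := Hj _ (mT j); lia.
have M_notin i z : i \in [set a; b] -> z \in M i -> z \notin T.
  move=> iab /MP zM; apply/negP; rewrite -mTE => /imsetP[j _ zj].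
  have [ji|ji] := eqVneq j i; last by have := zM _ ji; rewrite zj ltnn.
  subst j; move: iab; rewrite !inE => /orP[]/eqP Ei; subst i.
    by have := zM b; rewrite eq_sym neq_ab zj mab ltnn => /(_ isT).
  by have := zM a; rewrite neq_ab zj -mab ltnn => /(_ isT).
have Mdisj z : z \in M a -> z \in M b -> False.
  move=> /MP za /MP zb; have [j Hj] := dTP z.
  have := Hj _ (mT j); have [ja|/za] := eqVneq j a; last by lia.
  by have := zb j; rewrite ja neq_ab => /(_ isT); lia.
have topM i : exists e, e \in M i /\ {in M i, forall z, F i z <= F i e}.
  have [z0 Hz0] := Hbig _ mmin i.
  have z0M : z0 \in M i by apply/MP.
  exists [arg max_(z > z0 in M i) F i z]; case: arg_maxnP => // e eM He; split=> //.
have [ea [eaM ea_max]] := topM a; have [eb [ebM eb_max]] := topM b.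
have dome i e : i \in [set a; b] -> e \in M i ->
    {in M i, forall z, F i z <= F i e} -> dominating (e |: T).
  move=> iab eM emax; apply/dominatingP=> z.
  case: (boolP (z \in M i)) => [zM|].
    exists i => t; rewrite !inE => /orP[/eqP->|tT]; first exact: emax.
    by apply: leq_trans (emax _ zM) _; apply: dM.
  rewrite inE negb_forall => /existsP[j]; rewrite negb_imply -leqNgt => /andP[ji zj].
  exists j => t; rewrite !inE => /orP[/eqP->|tT].
    by move/MP: eM => /(_ _ ji); lia.
  by apply: leq_trans zj _; apply: mmin.
have ea_eb : ea != eb by apply/eqP=> E; apply: (@Mdisj ea) => //; rewrite E.
have aab : a \in [set a; b] by rewrite !inE eqxx.
have bab : b \in [set a; b] by rewrite !inE eqxx orbT.
have uniq_e i e z : i \in [set a; b] -> e \in M i ->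
    {in M i, forall z, F i z <= F i e} -> z \in M i -> dominating (z |: T) -> z = e.
  move=> iab eM emax zM /dominatingP /(_ e) [j Hj].
  have [ji|ji] := eqVneq j i.
    subst j; apply: (@F_inj i); apply/eqP.
    by rewrite eqn_leq emax //= Hj // !inE eqxx.
  have := Hj (m j); rewrite !inE mT orbT => /(_ isT).
  by move/MP: eM => /(_ _ ji); lia.
suff -> : [set z | z \notin T & dominating (z |: T)] = [set ea; eb].
  by rewrite cards2 ea_eb.
apply/setP=> z; rewrite !inE; apply/idP/idP; last first.
  case/orP=> /eqP->.
    by rewrite (M_notin a) //= (dome a).
  by rewrite (M_notin b) //= (dome b).
case/andP=> zT dz.
(* Conversely, [z |: T] has as many elements as there are orders, so its minimum map [m'] is
   injective. It agrees with [m] except at the order [i] where [z] is the minimum; as [m a = m b],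
   this [i] must be [a] or [b]. *)
have zT0 : z |: T != set0 by apply/set0Pn; exists z; rewrite !inE eqxx.
have [m' [m'T m'min]] := argmin_of zT0.
have m'E := argmin_onto dz m'T m'min.
have m'_inj : injective m'.
  have /imset_injP H : #|m' @: [set: J]| == #|[set: J]|.
    by rewrite m'E cardsU1 zT add1n card_T cardsT.
  by move=> x y; apply: H; rewrite inE.
have : z \in m' @: [set: J] by rewrite m'E !inE eqxx.
case/imsetP=> i _ zi.
have m'm j : j != i -> m' j = m j.
  move=> ji; have m'jT : m' j \in T.
    have := m'T j; rewrite !inE => /orP[/eqP|//]; rewrite zi => /m'_inj E.
    by rewrite E eqxx in ji.
  apply: (@F_inj j); apply/eqP; rewrite eqn_leq mmin // m'min //.
  by rewrite !inE mT orbT.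
have iab : i \in [set a; b].
  apply: contraT; rewrite !inE negb_or => /andP[ia ib].
  have := m'm a; rewrite eq_sym ia => /(_ isT) Ea.
  have := m'm b; rewrite eq_sym ib => /(_ isT) Eb.
  by move: neq_ab; rewrite -(inj_eq m'_inj) Ea Eb mab eqxx.
have zM : z \in M i.
  apply/MP=> j ji; rewrite -(m'm _ ji) ltn_neqAle m'min ?inE ?eqxx // andbT.
  by rewrite (inj_eq (@F_inj j)) zi (inj_eq m'_inj).
move: (iab); rewrite !inE => /orP[]/eqP Ei; subst i.
  by rewrite (uniq_e a ea z) ?eqxx.
by rewrite (uniq_e b eb z) ?eqxx ?orbT.
Qed.

End Scarf.

(** * Parity of the number of doors of a room *)

Section Parity.
Local Open Scope nat_scope.

Lemma odd_sum_exists (T : finType) (P : pred T) (f : T -> nat) :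
  odd (\sum_(x | P x) f x) -> exists2 x, P x & odd (f x).
Proof.
move=> Hodd; have [x /andP[Px ox]|H] := pickP (fun x => P x && odd (f x)).
  by exists x.
move: Hodd; rewrite -[odd _]negbK; case/negP; elim/big_rec: _ => // x k Px ek.
by rewrite oddD; have := H x; rewrite Px /= => ->.
Qed.

(** If one such [z] exists, then [T] shows exactly the colours other than [i0], and exactly one of
    them twice. The removable elements are the two that share this colour. *)
Lemma card_missing_color (Z J : finType) (c : Z -> J) (T : {set Z}) (i0 : J) :
  #|T| = #|J| -> c @: T != [set: J] ->
  ~~ odd #|[set z in T | c @: (T :\ z) == [set~ i0]]|.
Proof.
move=> card_T cT.
have [->|] := eqVneq [set z in T | c @: (T :\ z) == [set~ i0]] set0.
  by rewrite cards0.
case/set0Pn=> z; rewrite inE => /andP[zT /eqP cz].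
have Tz : z |: (T :\ z) = T by rewrite setD1K.
have cTE : c @: T = [set~ i0].
  apply/eqP; rewrite eqEsubset -{2}cz imsetS ?subD1set // andbT.
  apply/subsetP=> j jT; rewrite !inE; apply/eqP=> ji; subst j.
  case/eqP: cT; apply/setP=> j; rewrite inE.
  have [->//|ji] := eqVneq j i0.
  have : j \in c @: (T :\ z) by rewrite cz !inE.
  by apply/subsetP; apply: imsetS; apply: subD1set.
have cz_inj : {in T :\ z &, injective c}.
  by apply/imset_injP; rewrite cz cardsC1 -card_T (cardsD1 z T) zT.
have : c z \in c @: (T :\ z) by rewrite cz -cTE imset_f.
case/imsetP=> w; rewrite !inE => /andP[wz wT] czw.
suff -> : [set z in T | c @: (T :\ z) == [set~ i0]] = [set z; w].
  by rewrite cards2 eq_sym wz.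
apply/setP=> u; rewrite !inE; apply/andP/orP; last first.
  case=> /eqP->; split=> //; first by rewrite cz.
  rewrite -cTE eqEsubset imsetS ?subD1set //=.
  apply/subsetP=> _ /imsetP[x xT ->].
  have [->|xw] := eqVneq x w; last by apply: imset_f; rewrite !inE xw.
  by rewrite -czw imset_f // !inE eq_sym wz.
case=> uT /eqP cu.
have [->|uz] := eqVneq u z; first by left.
right.
have : c u \in c @: (T :\ u) by rewrite cu -cTE imset_f.
case/imsetP=> v; rewrite !inE => /andP[vu vT] cuv.
have [vz|vz] := eqVneq v z.
  subst v; apply/eqP; apply: cz_inj; rewrite ?inE ?wz ?uz //.
  by rewrite cuv.
have := cz_inj u v; rewrite !inE uz vz uT vT => /(_ isT isT cuv) E.
by rewrite E eqxx in vu.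
Qed.

End Parity.

(** * Slack vectors and Scarf's colouring theorem *)

Section Slack.
Local Open Scope nat_scope.
Variables (X J : finType) (f : J -> X -> nat) (c : X -> J).
Hypothesis f_inj : forall j, injective (f j).

Let bound := (\max_j \max_x f j x).+2.

(* The slack vector [inr j] is the smallest element for the order [j] and lies
   above [X] for every other order. *)
Definition slack_order (j : J) (z : X + J) : nat :=
  match z with
  | inl x => (f j x).+1
  | inr k => if k == j then 0 else bound + enum_rank k
  end.

Definition slack_color (z : X + J) : J :=
  match z with inl x => c x | inr j => j end.

Lemma slack_order_lt j x : slack_order j (inl x) < bound.
Proof.
rewrite /= /bound !ltnS; apply: leq_trans (leq_bigmax j).
exact: (leq_bigmax x).
Qed.

Lemma slack_order_inj j : injective (slack_order j).
Proof.
have lt := slack_order_lt j.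
move=> [x|k] [y|l]; first by case=> /f_inj->.
- by have := lt x; rewrite /=; case: eqP => _; lia.
- by have := lt y; rewrite /=; case: eqP => _; lia.
rewrite /=; case: eqP => [->|_]; case: eqP => [->|_] //; try by rewrite /bound; lia.
by move/addnI/ord_inj/enum_rank_inj->.
Qed.

(** Each slack vector present is zero in its own order, so points of [X] can be dominated only
    through [i0]. The added element must therefore be the [f i0]-maximum of [X]; the slack vector of
    [i0] is zero there and fails. *)
Lemma slack_start (x0 : X) (i0 : J) :
  #|[set z | z \notin inr @: [set~ i0] & dominating slack_order (z |: inr @: [set~ i0])]| = 1.
Proof.
pose x := [arg max_(x > x0) f i0 x].
have xmax y : f i0 y <= f i0 x by rewrite /x; case: arg_maxnP => // e _; apply.
apply/eqP/cards1P; exists (inl x); apply/setP=> z; rewrite !inE.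
apply/andP/eqP=> [[zT /dominatingP dz]|->]; last first.
  split; first by apply/imsetP=> -[].
  apply/dominatingP=> -[y|k].
    exists i0 => t; rewrite !inE => /orP[/eqP->|/imsetP[j ji ->]].
      by rewrite /= ltnS.
    move: ji; rewrite !inE => /negPf ji.
    by have := slack_order_lt i0 y; rewrite /= ji; lia.
  by exists k => t _; rewrite /= eqxx.
have di y : {in z |: inr @: [set~ i0], forall t, slack_order i0 (inl y) <= slack_order i0 t}.
  have [j Hj] := dz (inl y); suff ji : j = i0 by move: Hj; rewrite ji.
  apply/eqP; apply: contraT => ji; have := Hj (inr j).
  by rewrite !inE imset_f ?inE // orbT /= eqxx => /(_ isT).
case: z zT dz di => [z|k] zT _ di.
  congr (inl _); apply: (@f_inj i0); apply/eqP; rewrite eqn_leq xmax /=.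
  by have := di x (inl z); rewrite !inE eqxx => /(_ isT).
have ki : k = i0.
  by apply/eqP; apply: contraNT zT => ki; rewrite imset_f ?inE.
by have := di x0 (inr k); rewrite !inE eqxx ki /= eqxx => /(_ isT).
Qed.

(** A point of [X] in [T] keeps all minima of [T] below [bound], so [inr i] lies above them in every
    order except [i]. *)
Lemma slack_extensions (T : {set X + J}) (x0 : X) :
  inl x0 \in T -> #|T|.+1 = #|J| -> dominating slack_order T ->
  #|[set z | z \notin T & dominating slack_order (z |: T)]| = 2.
Proof.
move=> x0T card_T dT; apply: dominating_extensions => //.
- exact: slack_order_inj.
- by apply/set0Pn; exists (inl x0).
move=> m mmin i; exists (inr i) => j ji.
have := mmin j _ x0T; have := slack_order_lt j x0.
by rewrite [slack_order _ (inr i)]/= eq_sym (negPf ji); lia.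
Qed.

Theorem scarf_coloring (x0 : X) (i0 : J) : exists T : {set X + J},
  [/\ #|T| = #|J|, dominating slack_order T & slack_color @: T = [set: J]].
Proof.
(* Count modulo 2 the pairs (room, door) where the door is the room minus one
   element: a room with all colours has one door, any other room has none or
   two; every door lies in two rooms, except the set of slack vectors other than
   [i0], which lies in one. *)
pose room := [pred T : {set X + J} | (#|T| == #|J|) && dominating slack_order T].
pose door := [pred T : {set X + J} | (#|T|.+1 == #|J|) && dominating slack_order T
                & slack_color @: T == [set~ i0]].
suff [T /andP[/eqP card_T dT] oddT] :
    exists2 T, room T & odd #|[set z in T | slack_color @: (T :\ z) == [set~ i0]]|.
  exists T; split=> //; apply/eqP; apply: contraLR oddT => cT.
  exact: card_missing_color.
apply: odd_sum_exists.
have -> : \sum_(T | room T) #|[set z in T | slack_color @: (T :\ z) == [set~ i0]]| =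
          \sum_(T | door T) #|[set z | z \notin T & dominating slack_order (z |: T)]|.
  (* Double counting: [h] removes the marked element and maps the incidences [E1], seen from rooms,
     bijectively onto the incidences [E2], seen from doors. *)
  pose E1 := [set p : {set X + J} * (X + J) | room p.1 &
    (p.2 \in p.1) && (slack_color @: (p.1 :\ p.2) == [set~ i0])].
  pose E2 := [set p : {set X + J} * (X + J) | door p.1 &
    (p.2 \notin p.1) && dominating slack_order (p.2 |: p.1)].
  transitivity #|E1|.
    rewrite -sum1_card (eq_bigl (fun p => room p.1 && (p.2 \in [set z in p.1 | slack_color @: (p.1 :\ z) == [set~ i0]]))).
      rewrite -(pair_big_dep room (fun T z => z \in [set z in T | slack_color @: (T :\ z) == [set~ i0]]) (fun _ _ => 1)).
      by apply: eq_bigr => T _; rewrite sum1_card.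
    by case=> T z; rewrite !inE.
  transitivity #|E2|; last first.
    rewrite -sum1_card (eq_bigl (fun p => door p.1 && (p.2 \in [set z | z \notin p.1 & dominating slack_order (z |: p.1)]))).
      rewrite -(pair_big_dep door (fun T z => z \in [set z | z \notin T & dominating slack_order (z |: T)]) (fun _ _ => 1)).
      by apply: eq_bigr => T _; rewrite sum1_card.
    by case=> T z; rewrite !inE.
  pose h (p : {set X + J} * (X + J)) := (p.1 :\ p.2, p.2).
  have h_inj : {in E1 &, injective h}.
    move=> [T z] [U w]; rewrite !inE /= => /andP[_ /andP[zT _]] /andP[_ /andP[wU _]].
    by case=> E zw; subst w; rewrite -(setD1K zT) E setD1K.
  rewrite -(card_in_imset h_inj); apply: eq_card => -[T z].
  apply/imsetP/idP.
    case=> -[U w] /=; rewrite !inE /= => /andP[/andP[cU dU] /andP[wU cw]] [-> ->].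
    rewrite cw setD1K // dU !inE eqxx /= !andbT.
    rewrite (cardsD1 w U) wU in cU; rewrite cU /=.
    apply/dominatingP => y; move/dominatingP: dU => /(_ y) [j Hj].
    by exists j => t /setD1P[_ tU]; apply: Hj.
  rewrite !inE /= => /andP[/andP[/andP[cT dT] sT] /andP[zT dz]].
  exists (z |: T, z); last by rewrite /h /= setU1K.
  by rewrite !inE /= cardsU1 zT cT dz setU1K // sT eqxx.
pose T0 : {set X + J} := inr @: [set~ i0].
have doorT0 : door T0.
  rewrite /= card_imset; last by move=> ? ? [].
  have J0 : 0 < #|J| by apply/card_gt0P; exists i0.
  rewrite cardsC1 prednK // eqxx /= -imset_comp imset_id eqxx andbT.
  apply/dominatingP => z; case: z => [y|k]; last first.
    by exists k => t _; rewrite /= eqxx.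
  exists i0 => t /imsetP[j]; rewrite !inE => /negPf ji ->.
  by have := slack_order_lt i0 y; rewrite /= ji; lia.
rewrite (bigD1 T0) //= slack_start // oddD /=.
apply/negP; apply/negP.
elim/big_rec: _ => // T k /andP[/andP[/andP[/eqP card_T dT] /eqP sT] TT0] ok.
(* A door consisting of slack vectors only is determined by its colours, hence equals [T0]. *)
suff [x xT] : exists x, inl x \in T by rewrite (slack_extensions xT) // oddD.
have [x xT|noX] := pickP (fun x => inl x \in T); first by exists x.
case/eqP: TT0; apply/setP=> -[x|k'].
  by rewrite noX; apply/esym/imsetP=> -[].
apply/idP/imsetP=> [kT|[j ji [->]]].
  by exists k' => //; rewrite -sT; apply/imsetP; exists (inr k').
move: ji; rewrite -sT => /imsetP[[x|l] lT /= ->] //.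
by rewrite noX in lT.
Qed.

End Slack.

(** * Grid points of the simplex and small multicoloured cells *)

Section Grid.
Local Open Scope nat_scope.
Variables (J : finType) (N : nat).

Definition grid := {v : {ffun J -> 'I_N.+1} | \sum_j v j == N}.

Definition entry (v : grid) (j : J) : nat := val v j.

Definition dist (v w : grid) : nat :=
  \sum_j ((entry v j - entry w j) + (entry w j - entry v j)).

Lemma grid_sum (v : grid) : \sum_j entry v j = N.
Proof. exact/eqP/(valP v). Qed.

Lemma entry_le (v : grid) j : entry v j <= N.
Proof. by rewrite -ltnS ltn_ord. Qed.

Lemma dist_triangle u v w : dist u w <= dist u v + dist v w.
Proof. by rewrite /dist -big_split; apply: leq_sum => j _ /=; lia. Qed.

Lemma distC u v : dist u v = dist v u.
Proof. by apply: eq_bigr => j _; rewrite addnC. Qed.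

Lemma dist_self v : dist v v = 0.
Proof. by apply: big1 => j _; rewrite subnn. Qed.

Lemma dist_coord (v w : grid) j :
  (entry v j <= entry w j + dist v w) * (entry w j <= entry v j + dist v w).
Proof. by rewrite /dist (bigD1 j) //=; split; lia. Qed.

Lemma gridP (y : J -> nat) : \sum_j y j = N -> exists v : grid, forall j, entry v j = y j.
Proof.
move=> ysum; have yN j : y j < N.+1 by rewrite ltnS -ysum (bigD1 j) //= leq_addr.
have vsum : \sum_j [ffun j => Ordinal (yN j)] j == N.
  by rewrite -[X in _ == X]ysum; apply/eqP; apply: eq_bigr => j _; rewrite ffunE.
by exists (exist (fun v : {ffun J -> 'I_N.+1} => \sum_j v j == N) _ vsum) => j; rewrite /entry /= ffunE.
Qed.

Lemma grid_above (y : J -> nat) (k : J) : \sum_j y j <= N ->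
  exists v : grid, forall j, y j <= entry v j.
Proof.
move=> yN; pose t := N - \sum_j y j.
have [|v Hv] := @gridP (fun j => y j + (j == k) * t).
  rewrite big_split /= [X in _ + X](bigD1 k) //= eqxx mul1n [X in _ + (_ + X)]big1;
    last by move=> j /negPf->.
  by rewrite addn0 /t; lia.
by exists v => j; rewrite Hv leq_addr.
Qed.

(** The whole entry at [j] is moved to [k]. *)
Lemma grid_clear (v : grid) (j k : J) : j != k ->
  exists2 w : grid, entry w j = 0 & dist v w = 2 * entry v j.
Proof.
move=> jk.
pose y i := if i == j then 0 else if i == k then entry v k + entry v j else entry v i.
have jsum (x : J -> nat) : \sum_i x i = x j + (x k + \sum_(i | (i != j) && (i != k)) x i).
  by rewrite (bigD1 j) //= [X in _ + X](bigD1 k) //= eq_sym.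
have [|w Hw] := @gridP y.
  rewrite -(grid_sum v) !jsum /y eqxx eq_sym (negPf jk) eqxx.
  rewrite (eq_bigr (entry v)); first by lia.
  by move=> i /andP[/negPf-> /negPf->].
exists w; first by rewrite Hw /y eqxx.
rewrite /dist jsum big1 ?Hw /y; last first.
  by move=> i /andP[/negPf ij /negPf ik]; rewrite Hw /y ij ik subnn.
rewrite eqxx eq_sym (negPf jk) eqxx; lia.
Qed.

(** Lexicographic: coordinate [j] first, then the enumeration rank, which breaks ties and makes the
    order injective. *)
Definition grid_order (j : J) (v : grid) : nat := entry v j * #|{: grid}| + enum_rank v.

Lemma grid_order_le j (v w : grid) : grid_order j v <= grid_order j w -> entry v j <= entry w j.
Proof.
rewrite /grid_order => H; rewrite leqNgt; apply/negP => lt.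
have := ltn_ord (enum_rank w); set K := #|_| in H * => wK.
by have := leq_mul lt (leqnn K); rewrite mulSn; lia.
Qed.

Lemma grid_order_inj j : injective (grid_order j).
Proof.
move=> v w E.
have vw : entry v j = entry w j.
  by apply/eqP; rewrite eqn_leq !grid_order_le // E.
by move: E; rewrite /grid_order vw => /addnI/ord_inj/enum_rank_inj.
Qed.

(** [C] collects the rooms whose slack vector is absent from Scarf's set [T], so their colours come
    from grid points of [T]. Domination leaves these points little room above their common minima,
    which makes them close together and almost zero outside [C]. *)
Lemma small_colored_cell (j0 : J) (c : grid -> J) :
  exists (s0 : grid) (C : {set J}), [/\ C != set0,
    forall j, j \in C -> exists s, c s = j /\ dist s0 s < 2 * #|J| &
    forall j, j \notin C -> entry s0 j < #|J|].
Proof.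
have [x0 _] : exists x : grid, forall j, 0 <= entry x j.
  by apply: (@grid_above (fun=> 0) j0); rewrite sum_nat_const muln0.
have [T [card_T /dominatingP dT cT]] := scarf_coloring c grid_order_inj x0 j0.
pose C := [set j | inr j \notin T].
(* A slack vector in [T] is zero in its own order, so that order cannot dominate a grid point. *)
have domC (x : grid) : exists2 j, j \in C & forall s, inl s \in T -> entry x j <= entry s j.
  have [j Hj] := dT (inl x); exists j.
    by rewrite inE; apply/negP=> /Hj; rewrite /= eqxx.
  by move=> s /Hj /=; rewrite ltnS => /grid_order_le.
have colC j : j \in C -> exists2 s, inl s \in T & c s = j.
  move=> jC; have : j \in slack_color c @: T by rewrite cT.
  case/imsetP=> -[s|k] zT E; first by exists s.
  by move: jC; rewrite inE E zT.
have [jC jCC _] := domC x0; have [s0 s0T _] := colC _ jCC.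
pose mu j := entry [arg min_(s < s0 | inl s \in T) entry s j] j.
have mu_le j s : inl s \in T -> mu j <= entry s j.
  by move=> sT; rewrite /mu; case: arg_minnP => // i _; apply.
have muP j : exists2 s, inl s \in T & entry s j = mu j.
  rewrite /mu; case: arg_minnP => // s sT _; by exists s.
(* Otherwise some grid point would exceed every minimum [mu j] with [j] in [C]. *)
have sum_mu : N < \sum_(j in C) (mu j).+1.
  rewrite ltnNge; apply/negP; rewrite big_mkcond /= => /(@grid_above _ jC)[x Hx].
  have [j jinC Hj] := domC x; have [s sT sj] := muP j.
  by have := Hj s sT; have := Hx j; rewrite jinC sj; lia.
(* The left side is [N] minus the sum of [mu] over [C], which is less than [#|C|] by [sum_mu]. *)
have near s : inl s \in T ->
    \sum_(j in C) (entry s j - mu j) + \sum_(j | j \notin C) entry s j < #|J|.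
  move=> sT; have := grid_sum s; rewrite (bigID (mem C)) /=.
  have -> : \sum_(j in C) entry s j = \sum_(j in C) (entry s j - mu j) + \sum_(j in C) mu j.
    by rewrite -big_split /=; apply: eq_bigr => j _; rewrite subnK ?mu_le.
  move: sum_mu; have -> : \sum_(j in C) (mu j).+1 = \sum_(j in C) mu j + #|C|.
    by rewrite -sum1_card -big_split /=; apply: eq_bigr => j _; rewrite addn1.
  set n := #|J|; have : #|C| <= n by apply: max_card.
  lia.
exists s0, C; split; first by apply/set0Pn; exists jC.
  move=> j /colC[s sT cs]; exists s; split=> //.
  have := near _ s0T; have := near _ sT.
  suff : dist s0 s <= \sum_(j in C) (entry s j - mu j) + \sum_(j | j \notin C) entry s j +
    (\sum_(j in C) (entry s0 j - mu j) + \sum_(j | j \notin C) entry s0 j) by lia.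
  rewrite addnACA -!big_split /= /dist (bigID (mem C)) /=; apply: leq_add.
    by apply: leq_sum => i _; have := mu_le i _ sT; have := mu_le i _ s0T; lia.
  by apply: leq_sum => i _; lia.
move=> j jC'; apply: leq_ltn_trans (near _ s0T); rewrite [X in _ <= _ + X](bigD1 j) //=.
lia.
Qed.

End Grid.

(** * Shares and loads of the rooms on a fixed grid *)

Section Discrete.
Import mathcomp.algebra_tactics.ring mathcomp.algebra_tactics.lra.
Local Open Scope nat_scope.
Variables (I J : finType) (N : nat) (pref : I -> grid J N -> J -> bool).
Hypothesis card_I : #|I| = #|J|.+1.
Hypothesis pref_ne : forall i v, exists j, pref i v j.
Hypothesis pref_free : forall i v j, entry v j = 0 -> pref i v j.

Let n := #|J|.
(* Any value above [2 (m (m + 1))^2] makes [err_small] hold. *)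
Definition radius (m : nat) : nat := (2 * (m * m.+1 * (m * m.+1))).+1.
Let r := radius n.

(** Truncated subtraction supplies the maximum with 0, and the empty maximum gives 0 to a room that
    [i] never prefers. *)
Definition closeness (i : I) (j : J) (v : grid J N) : nat :=
  \max_(w | pref i w j) (r - dist v w).

Lemma closeness_le i j v : closeness i j v <= r.
Proof. by apply/bigmax_leqP => w _; rewrite leq_subr. Qed.

Lemma closeness_lip i j v w : closeness i j v <= closeness i j w + dist v w.
Proof.
apply/bigmax_leqP => u pu.
have := @leq_bigmax_cond _ (pref i ^~ j) (fun u => r - dist w u) u pu; rewrite -/(closeness i j w).
by have := dist_triangle w v u; rewrite (distC w v); lia.
Qed.

Lemma closeness_ge i j v w : pref i w j -> r - dist v w <= closeness i j v.
Proof. exact: leq_bigmax_cond. Qed.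

Lemma closeness_gt0 i j v : 0 < closeness i j v -> exists2 w, pref i w j & dist v w < r.
Proof.
move=> H; have [w /andP[pw dw]|H0] := pickP (fun w => pref i w j && (dist v w < r)).
  by exists w.
move: H; rewrite lt0n => /negP[]; rewrite -leqn0; apply/bigmax_leqP=> w pw.
by have := H0 w; rewrite pw /=; lia.
Qed.

Definition total i v := \sum_k closeness i k v.

Lemma total_ge i v : r <= total i v.
Proof.
have [j pj] := pref_ne i v; have := closeness_ge v pj.
by rewrite dist_self subn0 /total (bigD1 j) //=; lia.
Qed.

Lemma closeness_total i j v : closeness i j v <= total i v.
Proof. by rewrite /total (bigD1 j) //= leq_addr. Qed.

Lemma total_le i v : total i v <= n * r.
Proof.
by rewrite -sum_nat_const; apply: leq_sum => j _; apply: closeness_le.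
Qed.

Lemma total_lip i v w : total i v <= total i w + n * dist v w.
Proof.
rewrite -sum_nat_const -big_split /=; apply: leq_sum => j _; exact: closeness_lip.
Qed.

Import Order.TTheory GRing.Theory Num.Theory.
Local Open Scope ring_scope.

Definition share i j v : rat := (closeness i j v)%:R / (total i v)%:R.

Lemma total_gt0 i v : 0 < (total i v)%:R :> rat.
Proof. by rewrite ltr0n; apply: leq_trans (total_ge i v). Qed.

Lemma share_ge0 i j v : 0 <= share i j v.
Proof. by rewrite divr_ge0 ?ler0n. Qed.

Lemma share_sum i v : \sum_j share i j v = 1.
Proof.
by rewrite -mulr_suml -natr_sum divff // gt_eqF // total_gt0.
Qed.

Definition load j v := \sum_i share i j v.

Lemma load_sum v : \sum_j load j v = n%:R + 1.
Proof.
rewrite exchange_big /= (eq_bigr (fun=> 1)); last by move=> i _; apply: share_sum.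
by rewrite sumr_const card_I -natr1.
Qed.

(** Over a distance below [2 * n], a closeness changes by at most [2 * n] and a total by at most
    [2 * n ^ 2], while totals are at least [r]. *)
Let err : rat := (2 * n%:R ^+ 2 + 2 * n%:R) / r%:R.

Lemma r_gt0 : 0 < r%:R :> rat. Proof. by rewrite ltr0n. Qed.

Lemma share_lip i j v w : (dist v w < 2 * n)%nat -> share i j w - err <= share i j v.
Proof.
move=> d; rewrite /share.
have /(_ rat) := ler_nat _ (closeness i j w) (closeness i j v + 2 * n)%nat.
have -> : (closeness i j w <= closeness i j v + 2 * n)%nat.
  by have := closeness_lip i j w v; rewrite distC; lia.
have /(_ rat) := ler_nat _ (total i v) (total i w + 2 * n * n)%nat.
have -> : (total i v <= total i w + 2 * n * n)%nat.
  have := total_lip i v w.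
  by have := leq_mul (leqnn n) (ltnW d); lia.
have /(_ rat) := ler_nat _ (closeness i j w) (total i w).
have /(_ rat) := ler_nat _ r (total i v).
rewrite closeness_total total_ge !natrD !natrM.
have := total_gt0 i v; have := total_gt0 i w; have := r_gt0.
rewrite /err.
have := ler0n rat (closeness i j w); have := ler0n rat n.
move: (closeness i j w)%:R (closeness i j v)%:R (total i w)%:R (total i v)%:R => a b A B.
move: n%:R r%:R => m q m0 a0 q0 A0 B0 qB aA BA ab.
rewrite lerBlDr ler_pdivrMr //.
have -> : (b / B + (2 * m ^+ 2 + 2 * m) / q) * A =
   (b * A + (2 * m ^+ 2 + 2 * m) * A * (B / q)) / B.
  by field; rewrite !gt_eqF.
rewrite ler_pdivlMr //.
have Bq : 1 <= B / q by rewrite ler_pdivlMr // mul1r.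
have K0 : 0 <= (2 * m ^+ 2 + 2 * m) * A by nra.
have := ler_wpM2l K0 Bq; nra.
Qed.

(** Room [j] becomes free within distance [2 * n], so its closeness is at least [r - 2 * n], out of
    a total of at most [n * r]. The quotient is [1 / n - 2 / r]. *)
Lemma share_free i j k v : j != k -> (entry v j < n)%nat -> n%:R^-1 - err <= share i j v.
Proof.
move=> jk vj; have [w wj dw] := grid_clear v jk; rewrite /share.
have n0 : (0 < n)%nat by apply/card_gt0P; exists j.
have : (r <= closeness i j v + 2 * n)%nat.
  by have := closeness_ge v (pref_free i wj); rewrite dw; lia.
rewrite -(ler_nat rat) natrD natrM.
have := total_le i v; rewrite -(ler_nat rat) natrM.
have := total_gt0 i v; have := r_gt0; rewrite /err.
have : (2 * n <= r)%nat.
  rewrite /r /radius; apply: leqW; rewrite leq_mul2l /=.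
  by rewrite -mulnA leq_pmulr // !muln_gt0 n0.
have : (1 <= n)%nat by [].
rewrite -!(ler_nat rat) natrM.
move: (closeness i j v)%:R (total i v)%:R => b B.
move: n%:R r%:R => m q m1 mq q0 B0 Bq qb.
have m0 : 0 < m by lra.
rewrite ler_pdivlMr //.
have le1 : m^-1 - (2 * m ^+ 2 + 2 * m) / q <= m^-1 - 2 / q.
  by rewrite lerD2l lerN2 ler_pM2r ?invr_gt0 //; nra.
have ge0 : 0 <= m^-1 - 2 / q.
  have -> : m^-1 - 2 / q = (q - 2 * m) / (m * q) by field; rewrite !gt_eqF.
  by apply: divr_ge0; nra.
apply: le_trans (ler_wpM2r (ltW B0) le1) _.
apply: le_trans (ler_wpM2l ge0 Bq) _.
have -> : (m^-1 - 2 / q) * (m * q) = q - 2 * m by field; rewrite !gt_eqF.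
lra.
Qed.

Lemma err_small : (0 < n)%nat -> 1 < (n%:R + 1) * (n%:R^-1 - err).
Proof.
move=> n0; have rE : r%:R = 2 * (n%:R * (n%:R + 1) * (n%:R * (n%:R + 1))) + 1 :> rat.
  by rewrite [n%:R + 1]natr1 -!natrM natr1.
rewrite /err rE.
have : 0 < n%:R :> rat by rewrite ltr0n.
move: n%:R => m m0.
set q := 2 * (m * (m + 1) * (m * (m + 1))) + 1.
have q0 : 0 < q by rewrite /q; nra.
(* By the choice of [radius], the last numerator equals 1. *)
have -> : (m + 1) * (m^-1 - (2 * m ^+ 2 + 2 * m) / q) = 1 + (q - 2 * m ^+ 2 * (m + 1) ^+ 2) / (m * q).
  by field; rewrite !gt_eqF.
by rewrite ltrDl divr_gt0 ?mulr_gt0 // /q; lra.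
Qed.

(** Colour each point by a room with at least the average load [(n + 1) / n]. In a small cell, a
    room of [C] has this load at a nearby point and loses at most [err] per roommate; a room outside
    [C] is almost free, so [share_free] applies to every roommate. *)
Lemma load_gt1 (j0 : J) : exists v, forall j, 1 < load j v.
Proof.
have n0 : (0 < n)%nat by apply/card_gt0P; exists j0.
have n0r : 0 < n%:R :> rat by rewrite ltr0n.
have [c Hc] : exists c : grid J N -> J, forall v, (n%:R + 1) / n%:R <= load (c v) v.
  apply: (@fin_all_exists _ _ (fun v j => is_true ((n%:R + 1) / n%:R <= load j v))) => v.
  have [j Hj|H] := pickP (fun j => (n%:R + 1) / n%:R <= load j v); first by exists j.
  have : \sum_j load j v < \sum_(j : J) ((n%:R + 1) / n%:R).
    apply: ltr_sum => [|j _]; first by apply/hasP; exists j0; rewrite ?mem_index_enum.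
    by have := H j; rewrite leNgt => /negbFE.
  by rewrite load_sum sumr_const -(mulr_natr (_ / _)) divfK ?ltxx // gt_eqF.
have [v [C [/set0Pn[k kC] near off]]] := small_colored_cell j0 c.
exists v => j; apply: lt_le_trans (err_small n0) _.
have cI : (n%:R + 1) = #|I|%:R :> rat by rewrite card_I -natr1.
have [jC|jC] := boolP (j \in C); last first.
  rewrite cI mulr_natl -sumr_const; apply: ler_sum => i _.
  apply: (share_free i (k := k)); last exact: off.
  by apply: contraNneq jC => ->.
have [s [sj ds]] := near j jC; have := Hc s; rewrite sj mulrBr => le_s.
apply: le_trans (lerB le_s (lexx _)) _.
rewrite cI mulr_natl -sumr_const -sumrB; apply: ler_sum => i _.
exact: share_lip.
Qed.

(** The rooms of [K] carry total load above [#|K|]. Only roommates close to preferring a room of [K]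
    contribute, each at most 1. *)
Theorem discrete_surplus (j0 : J) : exists v : grid J N, forall K : {set J}, K != set0 ->
  (#|K| < #|[set i | [exists j in K, [exists w, pref i w j && (dist v w < r)%nat]]]|)%nat.
Proof.
have [v Hv] := load_gt1 j0; exists v => K /set0Pn[k kK].
set NK := [set i | _].
rewrite -(ltr_nat rat).
have -> : #|K|%:R = \sum_(j in K) 1 :> rat by rewrite sumr_const.
have lt : \sum_(j in K) 1 < \sum_(j in K) load j v.
  by apply: ltr_sum => [|j _ //]; apply/hasP; exists k; rewrite ?mem_index_enum.
apply: lt_le_trans lt _; rewrite exchange_big /= (bigID (mem NK)) /=.
rewrite [X in _ + X]big1 ?addr0; last first.
  move=> i iN; apply: big1 => j jK; apply/eqP; rewrite mulf_eq0 pnatr_eq0.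
  apply/orP; left; rewrite -leqn0 leqNgt; apply: contra iN => /closeness_gt0[w pw dw].
  by rewrite inE; apply/existsP; exists j; rewrite jK; apply/existsP; exists w; rewrite pw.
rewrite -sumr_const; apply: ler_sum => i _; rewrite -(share_sum i v).
by rewrite [leRHS](bigID (mem K)) /= lerDl sumr_ge0 // => j _; apply: share_ge0.
Qed.

End Discrete.

(** * Hall's theorem and matchings with one roommate removed *)

Section Hall.
Local Open Scope nat_scope.

(* Rado's argument: if some [N x] has two elements, one of them can be removed
   without violating Hall's condition. *)
Theorem hall (S Y : finType) (N : S -> {set Y}) :
  (forall A : {set S}, #|A| <= #|\bigcup_(x in A) N x|) ->
  exists2 g : S -> Y, injective g & forall x, g x \in N x.
Proof.
have [k] := ubnP (\sum_x #|N x|); elim: k N => // k IHk N lek hallN.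
have [x Nx|small] := pickP (fun x => 1 < #|N x|); last first.
  have Ng x : exists y, N x == [set y].
    have : #|N x| == 1.
      rewrite eqn_leq leqNgt small /=.
      by have := hallN [set x]; rewrite cards1 big_set1.
    by case/cards1P=> y ->; exists y.
  have [g Hg] := fin_all_exists Ng.
  exists g => [x y gxy|x]; last by rewrite (eqP (Hg x)) !inE.
  apply/eqP; apply: contraT => xy; have := hallN [set x; y].
  by rewrite cards2 xy big_setU1 ?inE // big_set1 (eqP (Hg x)) (eqP (Hg y)) gxy /= setUid cards1.
have /card_gt1P[y1 [y2 [y1N y2N y12]]] := Nx.
pose del y z := if z == x then N x :\ y else N z.
have step y : y \in N x -> (forall A : {set S}, #|A| <= #|\bigcup_(z in A) del y z|) ->
    exists2 g : S -> Y, injective g & forall x, g x \in N x.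
  move=> yN hd; have [|g g_inj Hg] := IHk (del y) _ hd.
    move: lek; rewrite (bigD1 x) //= [X in _ -> X < k](bigD1 x) //= {1}/del eqxx.
    rewrite (cardsD1 y (N x)) yN [X in _ -> _ + X < k](eq_bigr (fun z => #|N z|)); first by lia.
    by move=> z /negPf zx; rewrite /del zx.
  exists g => // z; have := Hg z; rewrite /del; case: eqP => // ->.
  by case/setD1P.
have fails y : ~~ [forall A : {set S}, #|A| <= #|\bigcup_(z in A) del y z|] ->
    exists2 A : {set S}, x \in A & #|\bigcup_(z in A) del y z| < #|A|.
  rewrite negb_forall => /existsP[A]; rewrite -ltnNge => ltA; exists A => //.
  apply: contraLR ltA => xA; rewrite -leqNgt (eq_bigr N) // => z zA.
  by rewrite /del; case: eqP zA xA => // -> ->.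
have [/forallP/(step _ y1N)//|/fails[A1 xA1 lt1]] :=
  boolP [forall A : {set S}, #|A| <= #|\bigcup_(z in A) del y1 z|].
have [/forallP/(step _ y2N)//|/fails[A2 xA2 lt2]] :=
  boolP [forall A : {set S}, #|A| <= #|\bigcup_(z in A) del y2 z|].
(* Each deleted element survives in the other family, so [B1 :|: B2] contains all neighbours of
   [A1 :|: A2], and [B1 :&: B2] those of the intersection without [x]. Hall's condition makes
   [#|B1| + #|B2|] at least [#|A1| + #|A2| - 1], but both violations make it at most
   [#|A1| + #|A2| - 2]. *)
exfalso; set B1 := \bigcup_(z in A1) _ in lt1; set B2 := \bigcup_(z in A2) _ in lt2.
have inB y z w (A : {set S}) : z \in A -> w \in N z -> (z != x) || (w != y) ->
    w \in \bigcup_(z in A) del y z.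
  move=> zA wN H; apply/bigcupP; exists z => //; rewrite /del.
  by case: eqP H wN => //= -> wy wN; rewrite !inE wy.
have subU : \bigcup_(z in A1 :|: A2) N z \subset B1 :|: B2.
  apply/bigcupsP => z zA; apply/subsetP => w wN; rewrite inE /B1 /B2.
  have [zx|zx] := eqVneq z x.
    rewrite zx in wN; have [wy|wy] := eqVneq w y1.
      by rewrite orbC (inB y2 x) // wy y12 orbT.
    by rewrite (inB y1 x) // wy orbT.
  by move: zA; rewrite inE => /orP[] zA;
    [rewrite (inB y1 z) ?zx | rewrite orbC (inB y2 z) ?zx].
have subI : \bigcup_(z in (A1 :&: A2) :\ x) N z \subset B1 :&: B2.
  apply/bigcupsP => z /setD1P[zx /setIP[zA1 zA2]]; apply/subsetP => w wN.
  by rewrite inE /B1 /B2 !(inB _ z) ?zx.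
have := hallN (A1 :|: A2); have := hallN ((A1 :&: A2) :\ x).
have := subset_leq_card subU; have := subset_leq_card subI.
have := cardsUI A1 A2; have := cardsUI B1 B2.
have := cardsD1 x (A1 :&: A2); rewrite inE xA1 xA2; lia.
Qed.

(** Removing [i] costs a set of rooms at most one neighbour, which the surplus absorbs. Hall's
    injection from rooms to remaining roommates is bijective by cardinality, and [sigma] is its
    inverse. *)
Lemma surplus_matching (I J : finType) (A : I -> J -> bool) :
  #|I| = #|J|.+1 ->
  (forall K : {set J}, K != set0 -> #|K| < #|[set a | [exists j in K, A a j]]|) ->
  forall i : I, exists sigma : {x : I | x != i} -> J,
    bijective sigma /\ forall a, A (val a) (sigma a).
Proof.
move=> card_I surplus i.
pose N j := [set a : {x : I | x != i} | A (val a) j].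
have [K|g g_inj gN] := @hall J {x : I | x != i} N.
  have [->|K0] := eqVneq K set0; first by rewrite cards0.
  have := surplus _ K0; rewrite (cardsD1 i) => lt.
  rewrite -(card_imset _ val_inj); apply: leq_trans (subset_leq_card (_ : _ :\ i \subset _)).
    exact: leq_trans lt (leq_add (leq_b1 _) (leqnn _)).
  apply/subsetP => a /setD1P[ai]; rewrite inE => /exists_inP[j jK Aaj].
  apply/imsetP; exists (Sub a ai); rewrite ?SubK //.
  by apply/bigcupP; exists j; rewrite // inE SubK.
have [|h gK hK] := inj_card_bij g_inj.
  by rewrite card_sig (eq_card (B := predC1 i)) // cardC1 card_I.
exists h; split; first by exists g.
by move=> a; have := gN (h a); rewrite hK inE.
Qed.

End Hall.

(** * Choice, limits and compactness *)

Lemma functional_choice (A B : Type) (P : A -> B -> Prop) :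
  (forall x, exists y, P x y) -> exists f, forall x, P x (f x).
Proof.
move=> H; exists (fun x => sval (constructive_indefinite_description _ (H x))) => x.
exact: svalP.
Qed.

Lemma finite_eventually (T : finType) (Q : T -> nat -> Prop) :
  (forall x, exists M, forall m, (M <= m)%nat -> Q x m) ->
  exists m, forall x, Q x m.
Proof.
move=> H; have [M HM] := functional_choice H.
exists (\max_x M x) => x; apply: (HM x); exact: leq_bigmax.
Qed.

Lemma Un_cv_const (c : R) : Un_cv (fun=> c) c.
Proof. by move=> e e0; exists 0%nat => m _; rewrite /R_dist /Rdist Rminus_diag Rabs_R0. Qed.

Lemma Un_cv_subseq (u : nat -> R) (l : R) (phi : nat -> nat) :
  (forall m, (m <= phi m)%nat) -> Un_cv u l -> Un_cv (fun m => u (phi m)) l.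
Proof.
move=> Hphi Hu e e0; have [M HM] := Hu e e0; exists M => m mM.
by apply: HM; have := Hphi m; lia.
Qed.

Lemma Un_cv_squeeze (u v : nat -> R) (l c : R) :
  (forall m, Rabs (u m - v m) <= c / INR m.+1) -> Un_cv v l -> Un_cv u l.
Proof.
move=> H Hv e e0.
have [M1 HM1] := Hv (e / 2) ltac:(lra).
(* Adding 1 to [Rabs c] keeps the denominator positive even for [c = 0]. *)
have [M2 [HM2 HM20]] := archimed_cor1 (e / (2 * (Rabs c + 1)))
  ltac:(apply: Rdiv_lt_0_compat; have := Rabs_pos c; lra).
exists (maxn M1 M2) => m mM.
have m1 : (m >= M1)%coq_nat by lia.
have := HM1 m m1; rewrite /R_dist /Rdist => lt1.
have c0 := Rabs_pos c.
have lt2 : c / INR m.+1 < e / 2.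
  have i0 : 0 < INR M2 by apply: lt_0_INR.
  have im : INR M2 <= INR m.+1 by apply: le_INR; lia.
  have h1 : / INR m.+1 <= / INR M2 by apply: Rinv_le_contravar.
  have h0 : 0 < / INR m.+1 by apply: Rinv_0_lt_compat; lra.
  apply: (Rle_lt_trans _ (Rabs c * / INR m.+1)).
    by apply: Rmult_le_compat_r; [lra | exact: Rle_abs].
  apply: (Rlt_le_trans _ ((Rabs c + 1) * (e / (2 * (Rabs c + 1))))); last first.
    by right; field; lra.
  nra.
have -> : u m - l = (u m - v m) + (v m - l) by ring.
have := Rabs_triang (u m - v m) (v m - l); have := H m; lra.
Qed.

(** The indices [phi m] are chosen near a cluster value of [u]. They need not increase: [m <= phi m]
    suffices for passing to limits. *)
Lemma bounded_subseq (u : nat -> R) (a b : R) :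
  (forall m, a <= u m <= b) ->
  exists (phi : nat -> nat) (l : R),
    (forall m, (m <= phi m)%nat) /\ Un_cv (fun m => u (phi m)) l.
Proof.
move=> Hu; have [l Hl] := Bolzano_Weierstrass _ _ (compact_P3 a b) Hu.
have close m : exists q, (m <= q)%nat /\ Rabs (u q - l) <= 1 / INR m.+1.
  have d0 : 0 < 1 / INR m.+1 by apply: Rdiv_lt_0_compat; [lra | apply: lt_0_INR; lia].
  have [|q [mq Hq]] := Hl (fun y => Rabs (y - l) <= 1 / INR m.+1) m.
    exists (mkposreal _ d0) => y; rewrite /disc /=; lra.
  by exists q; split=> //; lia.
have [phi Hphi] := functional_choice close.
exists phi, l; split=> [m|]; first by case: (Hphi m).
apply: (@Un_cv_squeeze _ (fun=> l) l 1) => [m|]; first by case: (Hphi m).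
exact: Un_cv_const.
Qed.

Lemma bounded_subseq_fin (T : finType) (s : nat -> T -> R) (a b : R) :
  (forall m i, a <= s m i <= b) ->
  exists (phi : nat -> nat) (p : T -> R),
    (forall m, (m <= phi m)%nat) /\ forall i, Un_cv (fun m => s (phi m) i) (p i).
Proof.
move=> Hs.
suff [phi [p [Hphi Hp]]] : exists (phi : nat -> nat) (p : T -> R),
    (forall m, (m <= phi m)%nat) /\
    forall i, i \in enum T -> Un_cv (fun m => s (phi m) i) (p i).
  by exists phi, p; split=> // i; apply: Hp; rewrite mem_enum.
elim: (enum T) => [|x r [phi [p [Hphi Hp]]]].
  by exists (fun m => m), (fun=> 0); split.
have [psi [l [Hpsi Hl]]] := bounded_subseq (fun m => Hs (phi m) x).
exists (fun m => phi (psi m)), (fun i => if i == x then l else p i); split=> [m|i].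
  by apply: leq_trans (Hpsi m) (Hphi _).
rewrite inE; case: eqP => [-> _ //|_ /= ir].
exact: (@Un_cv_subseq (fun m => s (phi m) i)) (Hp _ ir).
Qed.

Lemma rent_division_limit (n : nat) (rent : R) (s : nat -> 'I_n -> R) (p : 'I_n -> R) :
  (forall m, rent_division rent (s m)) ->
  (forall i, Un_cv (fun m => s m i) (p i)) -> rent_division rent p.
Proof.
move=> Hs Hp; split=> [j|].
  apply: Rnot_lt_le => pj; have [M HM] := Hp j (- p j) ltac:(lra).
  have := HM M (le_n M); rewrite /R_dist /Rdist.
  by have [/(_ j) s0 _] := Hs M; have := Rle_abs (s M j - p j); lra.
have cv : Un_cv (fun m => \big[Rplus/0]_(j < n) s m j) (\big[Rplus/0]_(j < n) p j).
  rewrite unlock; elim: (index_enum _) => [|i r IHr] /=; first exact: Un_cv_const.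
  exact: CV_plus (Hp i) IHr.
apply: (UL_sequence _ _ _ cv).
move=> e e0; exists 0%nat => m _; have [_ ->] := Hs m.
by rewrite /R_dist /Rdist Rminus_diag Rabs_R0.
Qed.

(** * From grid points to rent divisions, and the limit of finer grids *)

Definition grid_division (n N : nat) (rent : R) (v : grid 'I_n N) (j : 'I_n) : R :=
  rent / INR N * INR (entry v j).

Lemma grid_division_valid (n N : nat) (rent : R) (v : grid 'I_n N.+1) :
  0 <= rent -> rent_division rent (grid_division rent v).
Proof.
move=> rent0; have N0 : 0 < INR N.+1 by apply: lt_0_INR; lia.
have q0 : 0 <= rent / INR N.+1 by apply: Rle_mult_inv_pos.
split=> [j|]; first by apply: Rmult_le_pos => //; exact: pos_INR.
rewrite /grid_division.
rewrite -(big_morph (fun k : nat => rent / INR N.+1 * INR k) (id2 := 0%nat) (op2 := addn)).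
- by rewrite grid_sum; field; lra.
- by move=> x y; rewrite plus_INR; ring.
by rewrite /=; ring.
Qed.

Lemma grid_division_dist (n N : nat) (rent : R) (v w : grid 'I_n N) (d : nat) j :
  0 <= rent / INR N -> (dist v w < d)%nat ->
  Rabs (grid_division rent w j - grid_division rent v j) <= rent / INR N * INR d.
Proof.
move=> q0 dvw; rewrite /grid_division -Rmult_minus_distr_l Rabs_mult Rabs_pos_eq //.
apply: Rmult_le_compat_l => //; have [le1 le2] := dist_coord v w j.
have : INR (entry v j) <= INR (entry w j) + INR d.
  by rewrite -plus_INR; apply: le_INR; lia.
have : INR (entry w j) <= INR (entry v j) + INR d.
  by rewrite -plus_INR; apply: le_INR; lia.
by move=> h1 h2; apply: Rabs_le; lra.
Qed.

Definition boolify (P : Prop) : bool :=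
  if excluded_middle_informative P then true else false.

Lemma boolifyP (P : Prop) : reflect P (boolify P).
Proof. by rewrite /boolify; case: excluded_middle_informative => H; constructor. Qed.

(* k = n.+1 roommates (indexed by 'I_n.+1), k - 1 = n rooms (indexed by 'I_n).
   After kicking out roommate i, an envy-free assignment is a bijection
   sigma from the remaining roommates to the rooms. *)
Theorem theorem2p4 (n : nat) (rent : R) (pref : 'I_n.+1 -> preference n) :
  (0 < n)%coq_nat -> 0 <= rent ->
  (forall a, valid_pref rent (pref a)) ->
  exists p : 'I_n -> R, rent_division rent p /\
    forall i : 'I_n.+1, exists sigma : {x : 'I_n.+1 | x != i} -> 'I_n,
      bijective sigma /\ forall a, pref (val a) p (sigma a).
Proof.
move=> n0 rent0 valid.
have j0 : 'I_n by apply: (@Ordinal n 0); apply/ltP.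
have card_I : #|'I_n.+1| = #|'I_n|.+1 by rewrite !card_ord.
pose gpref N a (w : grid 'I_n N) j := boolify (pref a (grid_division rent w) j).
have gpref_ne N a w : exists j, @gpref N.+1 a w j.
  have [ne _] := valid a; have [j Hj] := ne _ (grid_division_valid w rent0).
  by exists j; apply/boolifyP.
have gpref_free N a w j : entry w j = 0%nat -> @gpref N.+1 a w j.
  move=> wj; have [_ [free _]] := valid a; apply/boolifyP.
  by apply: free (grid_division_valid w rent0) _; rewrite /grid_division wj Rmult_0_r.
pose r := radius #|'I_n|.
(* The grid size [m.+1] avoids division by zero. *)
have [v Hv] : exists v : forall m, grid 'I_n m.+1, forall m (K : {set 'I_n}), K != set0 ->
    (#|K| < #|[set a | [exists j in K, [exists w, gpref m.+1 a w j && (dist (v m) w < r)%nat]]]|)%nat.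
  pose H m := constructive_indefinite_description _
    (discrete_surplus card_I (@gpref_ne m) (@gpref_free m) j0).
  by exists (fun m => sval (H m)) => m; apply: (svalP (H m)).
pose s m := grid_division rent (v m).
have sdiv m : rent_division rent (s m) by apply: grid_division_valid.
have sbound m j : 0 <= s m j <= rent.
  have [s0 _] := sdiv m; split=> //; rewrite /s /grid_division.
  have N0 : 0 < INR m.+1 by apply: lt_0_INR; lia.
  have le : INR (entry (v m) j) <= INR m.+1 by apply/le_INR/leP; exact: entry_le.
  apply: (Rle_trans _ (rent / INR m.+1 * INR m.+1)); last by right; field; lra.
  by apply: Rmult_le_compat_l => //; apply: Rle_mult_inv_pos.
have [phi [p [Hphi Hp]]] := bounded_subseq_fin sbound.
have pdiv : rent_division rent p by apply: rent_division_limit (fun m => sdiv (phi m)) Hp.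
exists p; split=> //.
(* If this fails, arbitrarily fine grids contain divisions at which [a] prefers [j], within a
   vanishing price distance of the subsequence. They converge to [p], and closedness gives
   [pref a p j]. *)
have limit a j : exists M, forall m, (M <= m)%nat ->
    [exists w, gpref (phi m).+1 a w j && (dist (v (phi m)) w < r)%nat] -> pref a p j.
  have [paj|npaj] := excluded_middle_informative (pref a p j); first by exists 0%nat.
  apply: NNPP => noM; apply: npaj.
  have far M : exists q, [/\ rent_division rent q, pref a q j &
      exists2 m, (M <= m)%nat & forall i, Rabs (q i - s (phi m) i) <= rent * INR r / INR M.+1].
    apply: NNPP => noq; apply: noM; exists M => m Mm /existsP[w /andP[/boolifyP pw dw]].
    case: noq; exists (grid_division rent w); split=> //; first exact: grid_division_valid.
    exists m => // i.
    have i0 : 0 < INR M.+1 by apply: lt_0_INR; lia.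
    have im : INR M.+1 <= INR (phi m).+1 by apply: le_INR; have := Hphi m; lia.
    have h1 : / INR (phi m).+1 <= / INR M.+1 by apply: Rinv_le_contravar.
    have h0 : 0 < / INR (phi m).+1 by apply: Rinv_0_lt_compat; lra.
    have q0 : 0 <= rent / INR (phi m).+1 by apply: Rmult_le_pos => //; lra.
    apply: Rle_trans (grid_division_dist i q0 dw) _.
    have -> : rent * INR r / INR M.+1 = rent / INR M.+1 * INR r by field; lra.
    by apply: Rmult_le_compat_r; [exact: pos_INR | apply: Rmult_le_compat_l].
  have [t Ht] := functional_choice far.
  have near M : exists m, (M <= m)%nat /\
      forall i, Rabs (t M i - s (phi m) i) <= rent * INR r / INR M.+1.
    by have [_ _ [m Mm Hm]] := Ht M; exists m.
  have [psi Hpsi] := functional_choice near.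
  have [_ [_ closed]] := valid a.
  apply: (closed t) => //; try by move=> m; case: (Ht m).
  move=> i; apply: (Un_cv_squeeze (v := fun M => s (phi (psi M)) i)) => [M|].
    by case: (Hpsi M) => _; apply.
  by apply: (@Un_cv_subseq (fun m => s (phi m) i)) (Hp i) => M; case: (Hpsi M).
(* There are finitely many pairs, so a single grid serves them all and its surplus passes to [p]. *)
have [m Hm] : exists m, forall x : 'I_n.+1 * 'I_n,
    [exists w, gpref (phi m).+1 x.1 w x.2 && (dist (v (phi m)) w < r)%nat] -> pref x.1 p x.2.
  by apply: finite_eventually => -[a j]; apply: limit.
move=> i; have [|sigma [sb Hs]] :=
  surplus_matching (A := fun a j => boolify (pref a p j)) card_I _ i; last first.
  by exists sigma; split=> // a; apply/boolifyP.
move=> K K0; apply: leq_trans (Hv (phi m) _ K0) (subset_leq_card _).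
apply/subsetP => a; rewrite !inE => /exists_inP[j jK H].
by apply/exists_inP; exists j => //; apply/boolifyP; apply: (Hm (a, j)).
Qed.
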